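(* The category $\mathtt{Alg}(\mathsf{Com})$ of algebras over the symmetric operad $\mathsf{Com}$ is isomorphic (as a category) to the category $\mathtt{CommAlg}_{\mathbb K}$ of (not necessarily unital) commutative associative $\mathbb K$-algebras.
   Context: $\mathbb K$ is a field of characteristic $0$; vector spaces, linear maps and tensor products are over $\mathbb K$. $\mathbb S_n$ is the symmetric group. The symmetric operad $\mathsf{Com}$: $\mathsf{Com}(0)=0$; $\mathsf{Com}(n)=\mathbb K\{\mu_n\}$ is one-dimensional with basis element $\mu_n$ for $n\ge1$; $\mathbb S_n$ acts trivially, $\mu_n\cdot\sigma=\mu_n$; the (multilinear) composition is determined by $\mu_n\circ(\mu_{k_1},\dots,\mu_{k_n})=\mu_{k_1+\cdots+k_n}$ for $n,k_i\ge1$ (compositions involving $\mathsf{Com}(0)=0$ are zero); the unit is $\mu_1$. For a vector space $V$, the symmetric endomorphism operad has $\mathrm{End}_V^{\mathrm{sym}}(n)=\mathrm{Hom}(V^{\otimes n},V)$ (with $V^{\otimes0}=\mathbb K$), composition $f\circ(f_1\otimes\cdots\otimes f_n)$ of multilinear maps, unit $\mathrm{id}_V$, and right $\mathbb S_n$-action $(f\cdot\sigma)(v_1\otimes\cdots\otimes v_n)=f(v_{\sigma^{-1}(1)}\otimes\cdots\otimes v_{\sigma^{-1}(n)})$. An algebra over a symmetric operad $\mathcal P$ is a pair $(V,\Phi)$ with $V$ a vector space and $\Phi:\mathcal P\to\mathrm{End}^{\mathrm{sym}}_V$ a morphism of symmetric operads, i.e. a family of linear maps $\Phi_n:\mathcal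 P(n)\to\mathrm{Hom}(V^{\otimes n},V)$, $n\ge0$, preserving composition and unit and satisfying $\Phi_n(\theta\cdot\sigma)=\Phi_n(\theta)\cdot\sigma$. A morphism $(V,\Phi^V)\to(W,\Phi^W)$ is a linear map $f:V\to W$ with $f\circ\Phi^V_n(\theta)=\Phi^W_n(\theta)\circ f^{\otimes n}$ for all $n\ge0$, $\theta\in\mathcal P(n)$. These form the category $\mathtt{Alg}(\mathcal P)$. $\mathtt{CommAlg}_{\mathbb K}$ has as objects vector spaces with an associative commutative bilinear product (no unit required) and as morphisms linear maps preserving products. *)

(* Defs.v *)
From HB Require Import structures.
From mathcomp Require Import all_boot all_order all_algebra all_fingroup.
From mathcomp Require Import boolp functions.

Set Implicit Arguments.
Unset Strict Implicit.
Unset Printing Implicit Defensive.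

Import Order.TTheory GRing.Theory.
Local Open Scope ring_scope.

Structure category := Category {
  ob : Type;
  hom : ob -> ob -> Type;
  idm : forall x, hom x x;
  compm : forall x y z, hom y z -> hom x y -> hom x z;
  compm1 : forall x y (f : hom x y), compm f (idm x) = f;
  comp1m : forall x y (f : hom x y), compm (idm y) f = f;
  compmA : forall x y z t (h : hom z t) (g : hom y z) (f : hom x y),
    compm h (compm g f) = compm (compm h g) f
}.
Arguments idm {c} x.
Arguments compm {c x y z} g f.

Structure functor (C D : category) := Functor {
  fob :> ob C -> ob D;
  fhom : forall x y, hom x y -> hom (fob x) (fob y);
  fhom1 : forall x, fhom (idm x) = idm (fob x);
  fhomM : forall x y z (g : hom y z) (f : hom x y),
    fhom (compm g f) = compm (fhom g) (fhom f)
}.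
Arguments fhom {C D} F {x y} f : rename.

Definition idF (C : category) : functor C C :=
  @Functor C C id (fun _ _ f => f) (fun _ => erefl) (fun _ _ _ _ _ => erefl).

Section FunctorComposition.
Variables (C D E : category) (G : functor D E) (F : functor C D).

Let compF_hom x y (f : hom x y) : hom (G (F x)) (G (F y)) := fhom G (fhom F f).

Let compF_1 x : compF_hom (idm x) = idm (G (F x)).
Proof. by rewrite /compF_hom !fhom1. Qed.

Let compF_M x y z (g : hom y z) (f : hom x y) :
  compF_hom (compm g f) = compm (compF_hom g) (compF_hom f).
Proof. by rewrite /compF_hom !fhomM. Qed.

Definition compF : functor C E := Functor compF_1 compF_M.
End FunctorComposition.

(* The equalities of functors are strict, so this is isomorphism and not       *)
(* merely equivalence of categories.                                           *)
Definition isomorphic_cat (C D : category) : Prop :=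
  exists (F : functor C D) (G : functor D C),
    compF G F = idF C /\ compF F G = idF D.

(* The position Rank i j = k 0 + ... + k (i - 1) + j is that of the j-th input *)
(* of the i-th block when blocks of sizes k 0, ..., k (n - 1) are juxtaposed;  *)
(* sig1 and sig2 recover i and j.                                              *)
Section BlockPermutations.
Import tagnat.
Variables (n : nat) (k : 'I_n -> nat).

Definition block_sum_fun (t : forall i, 'S_(k i)) (s : 'I_(\sum_(i < n) k i)) :
    'I_(\sum_(i < n) k i) :=
  Rank (sig1 s) (t (sig1 s) (sig2 s)).

Lemma block_sum_Rank t i (j : 'I_(k i)) :
  block_sum_fun t (Rank i j) = Rank i (t i j).
Proof. by rewrite /block_sum_fun /sig1 /sig2 /Rank rankK. Qed.

Lemma block_sum_inj t : injective (block_sum_fun t).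
Proof.
apply: (can_inj (g := block_sum_fun (fun i => (t i)^-1%g))) => s.
by rewrite {2}/block_sum_fun block_sum_Rank permK sig2K.
Qed.

(* The permutation t_1 (+) ... (+) t_n. *)
Definition block_sum t : 'S_(\sum_(i < n) k i) := perm (@block_sum_inj t).

Lemma sum_perm (s : 'S_n) : (\sum_(i < n) k i = \sum_(i < n) k (s i))%N.
Proof. by rewrite (reindex_inj (@perm_inj _ s)). Qed.

(* The permutation moving the j-th element of the i-th block of the            *)
(* decomposition k (s 0), ..., k (s (n - 1)) to the j-th element of the        *)
(* (s i)-th block of the decomposition k 0, ..., k (n - 1).                    *)
Definition block_perm_fun (s : 'S_n) (u : 'I_(\sum_(i < n) k i)) :
    'I_(\sum_(i < n) k i) :=
  let u' : 'I_(\sum_(i < n) k (s i)) := cast_ord (sum_perm s) u in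
  Rank (s (sig1 u')) (sig2 u').

Lemma block_perm_Rank (s : 'S_n) i (j : 'I_(k (s i))) :
  block_perm_fun s (cast_ord (esym (sum_perm s)) (Rank (p_ := k \o s) i j))
  = Rank (s i) j.
Proof.
rewrite /block_perm_fun cast_ordKV.
by rewrite /sig1 /sig2 /Rank (rankK (p_ := k \o s)).
Qed.

Lemma block_perm_inj (s : 'S_n) : injective (block_perm_fun s).
Proof.
move=> u v; rewrite /block_perm_fun.
move: (cast_ord _ u) (@cast_ord_inj _ _ (sum_perm s) u v) => u'.
move: (cast_ord _ v) => v' inj_uv eq_uv; apply: inj_uv.
rewrite -[u'](sig2K (p_ := k \o s)) -[v'](sig2K (p_ := k \o s)).
move: (f_equal sig eq_uv); rewrite /Rank !rankK.
move: (sig1 u') (sig2 u') (sig1 v') (sig2 v') => i j i' j' /= e.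
have ei : i = i' by have := congr1 (@tag _ _) e; rewrite /= => /perm_inj.
by move: j' e; rewrite -ei => j' /eqP; rewrite eq_Tagged /= => /eqP ->.
Qed.

Definition block_perm (s : 'S_n) : 'S_(\sum_(i < n) k i) :=
  perm (@block_perm_inj s).

End BlockPermutations.

Lemma big_tagnat (R : Type) (idx : R) (op : Monoid.com_law idx)
    n (k : 'I_n -> nat) (F : forall i, 'I_(k i) -> R) :
  \big[op/idx]_(i < n) \big[op/idx]_(j < k i) F i j =
  \big[op/idx]_(s < \sum_(i < n) k i) F (tagnat.sig1 s) (tagnat.sig2 s).
Proof.
by rewrite sig_big_dep/= (reindex _ (tagnat.sig_bij_on)).
Qed.

Lemma Rank_sig n (k : 'I_n -> nat) (l : forall i, 'I_(k i) -> nat)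
    (s : 'I_(\sum_(i < n) k i))
    (q : 'I_(l (tagnat.sig1 s) (tagnat.sig2 s))) :
  tagnat.Rank (p_ := fun s => l (tagnat.sig1 s) (tagnat.sig2 s)) s q =
  tagnat.Rank (p_ := fun i => \sum_(j < k i) l i j)%N (tagnat.sig1 s)
    (tagnat.Rank (p_ := l _) (tagnat.sig2 s) q) :> nat.
Proof.
rewrite !tagnat.RankEsum addnA; congr (_ + _)%N.
pose F i j := if (tagnat.rank (Tagged (fun i => 'I_(k i)) j) < s)%N
  then l i j else 0%N.
transitivity (\sum_(i < n) \sum_(j < k i) F i j)%N.
  rewrite (big_tagnat addn F) big_mkcond; apply: eq_bigr => u _.
  by rewrite /F -tagnat.sigE12 tagnat.sigK.
have FE i (j : 'I_(k i)) : F i j = if (i < tagnat.sig1 s)%N ||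
    (i == tagnat.sig1 s) && (j < tagnat.sig2 s)%N then l i j else 0%N.
  rewrite /F; congr (if _ then _ else _).
  have := tagnat.lt_rank (Tagged (fun i => 'I_(k i)) j) (tagnat.sig s).
  rewrite tagnat.sigK Order.SigmaOrder.ltEsig !leEord !ltEord /= => ->.
  rewrite -val_eqE /= /tagnat.sig2 /tagnat.sig1.
  case: (tagnat.sig s) => i' j' /=.
  case: (ltngtP i i') => //= /val_inj ii'; subst i'.
  by rewrite tagged_asE.
rewrite (bigID (fun i : 'I_n => i < tagnat.sig1 s)%N) /=; congr (_ + _)%N.
  by apply: eq_bigr => i lt_is; apply: eq_bigr => j _; rewrite FE lt_is.
rewrite (bigD1 (tagnat.sig1 s)) ?ltnn //= [X in (_ + X)%N]big1 ?addn0.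
  rewrite [RHS]big_mkcond; apply: eq_bigr => j _.
  by rewrite FE ltnn eqxx.
move=> i /andP[/negPf ge_is /negPf ne_is]; apply: big1 => j _.
by rewrite FE ge_is ne_is.
Qed.

(* Elements of P m and P n with m = n only propositionally are compared in    *)
(* the total space {n & P n}, i.e. as Tagged P x = Tagged P y.                *)
(* MathComp's t * s maps i to s (t i), i.e. it is the composite s o t, so     *)
(* op_actM is the axiom (x . s) . t = x . (s o t) of a right action.          *)
(* op_comp_actl is the usual equivariance axiom                               *)
(*   (x . s) o (y'_1, ..., y'_n)                                              *)
(*     = (x o (y'_(s^-1 1), ..., y'_(s^-1 n))) . block permutation,           *)
(* with y'_i := y_(s i).                                                      *)
Structure sym_operad (K : fieldType) := SymOperad {
  op_space :> nat -> lmodType K;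
  op_act : forall n, op_space n -> 'S_n -> op_space n;
  op_comp : forall n (k : 'I_n -> nat), op_space n ->
    (forall i, op_space (k i)) -> op_space (\sum_(i < n) k i)%N;
  op_unit : op_space 1;
  op_act_linear : forall n (s : 'S_n), linear (fun x : op_space n => op_act x s);
  op_act1 : forall n (x : op_space n), op_act x 1%g = x;
  op_actM : forall n (x : op_space n) (s t : 'S_n),
    op_act (op_act x s) t = op_act x (t * s)%g;
  op_comp_linearl : forall n (k : 'I_n -> nat) (y : forall i, op_space (k i)),
    linear (fun x => op_comp x y);
  op_comp_linearr : forall n (k : 'I_n -> nat) (x : op_space n)
      (y : forall i, op_space (k i)) (i : 'I_n),
    linear (fun z : op_space (k i) => op_comp x (dfwith y z));
  op_comp_unitl : forall n (x : op_space n),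
    Tagged op_space (op_comp op_unit (fun _ : 'I_1 => x)) = Tagged op_space x;
  op_comp_unitr : forall n (x : op_space n),
    Tagged op_space (op_comp x (fun _ : 'I_n => op_unit)) = Tagged op_space x;
  op_compA : forall n (k : 'I_n -> nat) (l : forall i, 'I_(k i) -> nat)
      (x : op_space n) (y : forall i, op_space (k i))
      (z : forall i (j : 'I_(k i)), op_space (l i j)),
    Tagged op_space (op_comp x (fun i => op_comp (y i) (z i))) =
    Tagged op_space (op_comp (op_comp x y)
      (fun s => z (tagnat.sig1 s) (tagnat.sig2 s)));
  op_comp_actl : forall n (k : 'I_n -> nat) (x : op_space n)
      (y : forall i, op_space (k i)) (s : 'S_n),
    Tagged op_space (op_comp (op_act x s) (fun i => y (s i))) =
    Tagged op_space (op_act (op_comp x y) (block_perm k s));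
  op_comp_actr : forall n (k : 'I_n -> nat) (x : op_space n)
      (y : forall i, op_space (k i)) (t : forall i, 'S_(k i)),
    op_comp x (fun i => op_act (y i) (t i)) =
    op_act (op_comp x y) (block_sum t)
}.
Arguments op_act {K P n} x s : rename.
Arguments op_comp {K P n k} x y : rename.
Arguments op_unit {K P} : rename.

Structure operad_morphism (K : fieldType) (P Q : sym_operad K) :=
  OperadMorphism {
  om_fun :> forall n, P n -> Q n;
  om_linear : forall n, linear (@om_fun n);
  om_comp : forall n (k : 'I_n -> nat) (x : P n) (y : forall i, P (k i)),
    om_fun (op_comp x y) = op_comp (om_fun x) (fun i => om_fun (y i));
  om_unit : om_fun op_unit = op_unit;
  om_act : forall n (x : P n) (s : 'S_n),
    om_fun (op_act x s) = op_act (om_fun x) s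
}.

Section Com.
Variable K : fieldType.

Definition com_space (n : nat) : lmodType K :=
  if n is _.+1 then K^o else 'rV[K]_0.

(* mu 0 = 0, and mu n is the basis of Com(n) for n > 0; com_coef gives the    *)
(* coordinate on mu n. As com_coef is 0 on Com(0), com_comp below vanishes as *)
(* soon as one of its arguments has arity 0.                                  *)
Definition mu (n : nat) : com_space n :=
  if n is _.+1 then 1 : K^o else 0 : 'rV[K]_0.

Definition com_coef (n : nat) : com_space n -> K :=
  if n is _.+1 then fun x => x else fun => 0.

Lemma com_coef_linear n (a : K) (x y : com_space n) :
  com_coef (a *: x + y) = a * com_coef x + com_coef y.
Proof. by case: n x y => [|n] x y //=; rewrite mulr0 addr0. Qed.

Lemma com_coefK n (x : com_space n) : com_coef x *: mu n = x.
Proof.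
by case: n x => [|n] x /=; [rewrite [x]thinmx0 thinmx0 | exact: mulr1].
Qed.

Lemma com_coef_mu n (c : K) : (n = 0%N -> c = 0) -> com_coef (c *: mu n) = c.
Proof. by case: n => [/(_ erefl)->|n _] //=; exact: mulr1. Qed.

Lemma com_coef0 n (x : com_space n) : n = 0%N -> com_coef x = 0.
Proof. by case: n x. Qed.

Definition com_act (n : nat) (x : com_space n) (s : 'S_n) : com_space n := x.

Definition com_comp (n : nat) (k : 'I_n -> nat) (x : com_space n)
    (y : forall i, com_space (k i)) : com_space (\sum_(i < n) k i)%N :=
  (com_coef x * \prod_(i < n) com_coef (y i)) *: mu (\sum_(i < n) k i)%N.

Lemma com_coef_comp n (k : 'I_n -> nat) (x : com_space n)
    (y : forall i, com_space (k i)) :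
  com_coef (com_comp x y) = com_coef x * \prod_(i < n) com_coef (y i).
Proof.
apply: com_coef_mu; case: n k x y => [|n] k x y; first by rewrite mul0r.
move/eqP; rewrite big_ord_recl addn_eq0 => /andP[/eqP k0 _].
by rewrite big_ord_recl (com_coef0 _ k0) mul0r mulr0.
Qed.

Lemma com_Tagged m n (x : com_space m) (y : com_space n) :
  m = n -> com_coef x = com_coef y -> Tagged com_space x = Tagged com_space y.
Proof.
by move=> e; subst n => e; rewrite -(com_coefK x) -(com_coefK y) e.
Qed.

Lemma com_inj n (x y : com_space n) : com_coef x = com_coef y -> x = y.
Proof. by move=> e; rewrite -(com_coefK x) -(com_coefK y) e. Qed.

Lemma com_act_linear n (s : 'S_n) : linear (fun x => com_act x s).
Proof. by []. Qed.

Lemma com_act1 n (x : com_space n) : com_act x 1%g = x.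
Proof. by []. Qed.

Lemma com_actM n (x : com_space n) (s t : 'S_n) :
  com_act (com_act x s) t = com_act x (t * s)%g.
Proof. by []. Qed.

Lemma com_comp_linearl n (k : 'I_n -> nat) (y : forall i, com_space (k i)) :
  linear (fun x => com_comp x y).
Proof.
move=> a x x'; apply: com_inj.
by rewrite com_coef_linear !com_coef_comp com_coef_linear mulrDl mulrA.
Qed.

Lemma com_comp_linearr n (k : 'I_n -> nat) (x : com_space n)
    (y : forall i, com_space (k i)) (i : 'I_n) :
  linear (fun z : com_space (k i) => com_comp x (dfwith y z)).
Proof.
move=> a z z'; apply: com_inj.
rewrite com_coef_linear !com_coef_comp !(bigD1 (P := predT) i) //=.
rewrite !dfwith_in com_coef_linear.
have e (u : com_space (k i)) : \prod_(j < n | j != i) com_coef (dfwith y u j)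
    = \prod_(j < n | j != i) com_coef (y j).
  by apply: eq_bigr => j ji; rewrite dfwith_out // eq_sym.
rewrite !e mulrDl mulrDr -[a * _ * _]mulrA.
by rewrite [com_coef x * (a * _)]mulrCA.
Qed.

Lemma com_comp_unitl n (x : com_space n) :
  Tagged com_space (com_comp (mu 1) (fun _ : 'I_1 => x)) = Tagged com_space x.
Proof.
apply: com_Tagged; first by rewrite big_ord1.
by rewrite com_coef_comp big_ord1; exact: mul1r.
Qed.

Lemma com_comp_unitr n (x : com_space n) :
  Tagged com_space (com_comp x (fun _ : 'I_n => mu 1)) = Tagged com_space x.
Proof.
apply: com_Tagged; first by rewrite sum1_card card_ord.
by rewrite com_coef_comp big1 //= mulr1.
Qed.

Lemma com_compA n (k : 'I_n -> nat) (l : forall i, 'I_(k i) -> nat)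
    (x : com_space n) (y : forall i, com_space (k i))
    (z : forall i (j : 'I_(k i)), com_space (l i j)) :
  Tagged com_space (com_comp x (fun i => com_comp (y i) (z i))) =
  Tagged com_space (com_comp (com_comp x y)
    (fun s => z (tagnat.sig1 s) (tagnat.sig2 s))).
Proof.
apply: com_Tagged; first exact: big_tagnat.
rewrite !com_coef_comp -mulrA; congr (_ * _).
rewrite (eq_bigr _ (fun i _ => com_coef_comp (y i) (z i))) big_split /=.
by rewrite -(big_tagnat _ (fun i j => com_coef (z i j))).
Qed.

Lemma com_comp_actl n (k : 'I_n -> nat) (x : com_space n)
    (y : forall i, com_space (k i)) (s : 'S_n) :
  Tagged com_space (com_comp (com_act x s) (fun i => y (s i))) =
  Tagged com_space (com_act (com_comp x y) (block_perm k s)).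
Proof.
apply: com_Tagged; first by rewrite -sum_perm.
by rewrite /com_act !com_coef_comp [in RHS](reindex_inj (@perm_inj _ s)).
Qed.

Lemma com_comp_actr n (k : 'I_n -> nat) (x : com_space n)
    (y : forall i, com_space (k i)) (t : forall i, 'S_(k i)) :
  com_comp x (fun i => com_act (y i) (t i)) =
  com_act (com_comp x y) (block_sum t).
Proof. by []. Qed.

Definition Com : sym_operad K :=
  SymOperad com_act_linear com_act1 com_actM com_comp_linearl com_comp_linearr
    com_comp_unitl com_comp_unitr com_compA com_comp_actl com_comp_actr.

End Com.

Notation fwith v i x := (@dfwith _ (fun=> _) v i x).

Section Multilinear.
Variables (K : fieldType) (V : lmodType K) (n : nat).

Definition multilinear (f : ('I_n -> V) -> V) : Prop :=
  forall (v : 'I_n -> V) (i : 'I_n), linear (fun x : V => f (fwith v i x)).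

Definition multilinear_pred : {pred ('I_n -> V) -> V} :=
  fun f => `[< multilinear f >].

Lemma multilinear_submod_closed : submod_closed multilinear_pred.
Proof.
split=> [|a f g /asboolP fl /asboolP gl]; apply/asboolP => v i b x y.
  by rewrite scaler0 addr0.
have fE : (a *: f + g) = (fun v => a *: f v + g v) by [].
rewrite !fE fl gl !scalerDr !scalerA -!addrA; congr (_ + _).
  by rewrite mulrC.
by rewrite addrCA.
Qed.

HB.instance Definition _ :=
  GRing.isSubmodClosed.Build K (('I_n -> V) -> V) multilinear_pred
    multilinear_submod_closed.

(* Hom(V^{(x) n}, V), by the universal property of the tensor power. *)
Record multilin := Multilin {
  multilin_fun :> ('I_n -> V) -> V;
  multilin_subproof : multilin_fun \in multilinear_pred
}.

HB.instance Definition _ := [isSub for multilin_fun].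
HB.instance Definition _ := [Choice of multilin by <:].
HB.instance Definition _ := [SubChoice_isSubLmodule of multilin by <:].

Lemma multilinP (f : multilin) : multilinear f.
Proof. exact/asboolP/multilin_subproof. Qed.

Definition mk_multilin (f : ('I_n -> V) -> V) (fl : multilinear f) : multilin :=
  Multilin (asboolT fl).

Lemma multilin_eq (f g : multilin) : f =1 g -> f = g.
Proof. by move=> /funext fg; apply: val_inj. Qed.

Lemma multilinDE a (f g : multilin) v : (a *: f + g) v = a *: f v + g v.
Proof. by []. Qed.

End Multilinear.

Section End.
Import tagnat.
Variables (K : fieldType) (V : lmodType K).

Definition end_space (n : nat) : lmodType K := multilin V n.

Lemma dfwith_comp n (s : 'S_n) (v : 'I_n -> V) (i : 'I_n) (x : V) :
  fwith v i x \o s = fwith (v \o s) (s^-1%g i) x.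
Proof.
apply: funext => j /=; case: (eqVneq (s^-1%g i) j) => [<-|ij].
  by rewrite permKV !dfwith_in.
by rewrite !dfwith_out //; apply: contra ij => /eqP ->; rewrite permK.
Qed.

Lemma end_act_subproof n (f : end_space n) (s : 'S_n) :
  multilinear (fun v : 'I_n -> V => f (fun i => v (s^-1%g i))).
Proof.
move=> v i a x y; have := multilinP f (v \o s^-1%g) (s^-1%g^-1%g i) a x y.
by rewrite -!dfwith_comp.
Qed.

Definition end_act (n : nat) (f : end_space n) (s : 'S_n) : end_space n :=
  mk_multilin (@end_act_subproof n f s).

Definition block (n : nat) (k : 'I_n -> nat)
    (v : 'I_(\sum_(i < n) k i) -> V) (i : 'I_n) (j : 'I_(k i)) : V :=
  v (Rank i j).

Lemma block_dfwith n (k : 'I_n -> nat) (f : forall i, end_space (k i)) v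
    (i : 'I_n) (j : 'I_(k i)) (x : V) :
  (fun i' => f i' (block (fwith v (Rank i j) x) (i := i'))) =
  fwith (fun i' => f i' (block v (i := i'))) i
    (f i (fwith (block v (i := i)) j x)).
Proof.
apply: funext => i'; case: (eqVneq i i') => [<-|ii'].
  rewrite dfwith_in; congr (f i _); apply: funext => j'; rewrite /block.
  case: (eqVneq j j') => [<-|jj']; first by rewrite !dfwith_in.
  rewrite !dfwith_out //; apply: contra jj' => /eqP /(congr1 val) /eqP.
  by rewrite eq_Rank eqxx.
rewrite dfwith_out //; congr (f i' _); apply: funext => j'; rewrite /block.
rewrite dfwith_out //; apply: contra ii' => /eqP /(congr1 val) /eqP.
by rewrite eq_Rank => /andP[].
Qed.

Lemma end_comp_subproof n (k : 'I_n -> nat) (f : end_space n)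
    (g : forall i, end_space (k i)) :
  multilinear (fun v : 'I_(\sum_(i < n) k i) -> V =>
    f (fun i => g i (fun j => v (Rank i j)))).
Proof.
move=> v s a x y; rewrite -[s]sig2K.
move: (sig1 s) (sig2 s) => i j; rewrite -!/(block _ _).
have e z := block_dfwith g v j z; rewrite /block in e.
by rewrite !e -multilinP -multilinP.
Qed.

Definition end_comp (n : nat) (k : 'I_n -> nat) (f : end_space n)
    (g : forall i, end_space (k i)) : end_space (\sum_(i < n) k i)%N :=
  mk_multilin (@end_comp_subproof n k f g).

Lemma end_unit_subproof : multilinear (fun v : 'I_1 -> V => v ord0).
Proof. by move=> v i a x y; rewrite (ord1 i) !dfwith_in. Qed.

Definition end_unit : end_space 1 := mk_multilin end_unit_subproof.

Lemma end_Tagged m n (f : end_space m) (g : end_space n) (e : m = n) :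
  (forall v : 'I_n -> V, f (fun i => v (cast_ord e i)) = g v) ->
  Tagged end_space f = Tagged end_space g.
Proof.
subst n => fg; congr (Tagged _ _); apply: multilin_eq => v.
by rewrite -fg; congr (f _); apply: funext => i; rewrite cast_ord_id.
Qed.

Lemma end_act_linear n (s : 'S_n) : linear (fun f : end_space n => end_act f s).
Proof. by move=> a f g; apply: multilin_eq. Qed.

Lemma end_act1 n (f : end_space n) : end_act f 1%g = f.
Proof.
apply: multilin_eq => v /=; congr (f _); apply: funext => i.
by rewrite invg1 perm1.
Qed.

Lemma end_actM n (f : end_space n) (s t : 'S_n) :
  end_act (end_act f s) t = end_act f (t * s)%g.
Proof.
apply: multilin_eq => v /=; congr (f _); apply: funext => i.
by rewrite invMg permM.
Qed.

Lemma end_comp_linearl n (k : 'I_n -> nat) (g : forall i, end_space (k i)) :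
  linear (fun f => end_comp f g).
Proof. by move=> a f f'; apply: multilin_eq. Qed.

Lemma end_comp_linearr n (k : 'I_n -> nat) (f : end_space n)
    (g : forall i, end_space (k i)) (i : 'I_n) :
  linear (fun h : end_space (k i) => end_comp f (dfwith g h)).
Proof.
move=> a h h'; apply: multilin_eq => v; rewrite multilinDE /=.
have e (u : end_space (k i)) :
    (fun i' => dfwith g u i' (fun j => v (Rank i' j))) =
    fwith (fun i' => g i' (fun j => v (Rank i' j))) i
      (u (fun j => v (Rank i j))).
  apply: funext => i'; case: (eqVneq i i') => [<-|ii'].
    by rewrite !dfwith_in.
  by rewrite !dfwith_out.
by rewrite !e -multilinP.
Qed.

Lemma end_comp_unitl n (f : end_space n) :
  Tagged end_space (end_comp end_unit (fun _ : 'I_1 => f)) =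
  Tagged end_space f.
Proof.
have e : (\sum_(i < 1) n)%N = n by rewrite big_ord1.
apply: (end_Tagged (e := e)) => v /=; congr (f _); apply: funext => j.
by congr v; apply: val_inj; rewrite [LHS]RankEsum big1 // => i; rewrite (ord1 i).
Qed.

Lemma end_comp_unitr n (f : end_space n) :
  Tagged end_space (end_comp f (fun _ : 'I_n => end_unit)) =
  Tagged end_space f.
Proof.
have e : (\sum_(i < n) 1)%N = n by rewrite sum1_card card_ord.
apply: (end_Tagged (e := e)) => v /=; congr (f _); apply: funext => i.
congr v; apply: val_inj; rewrite [LHS]RankEsum addn0 /=.
by rewrite -(big_ord_widen n (fun=> 1%N)) ?sum1_card ?card_ord // ltnW.
Qed.

Lemma end_comp_actr n (k : 'I_n -> nat) (f : end_space n)
    (g : forall i, end_space (k i)) (t : forall i, 'S_(k i)) :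
  end_comp f (fun i => end_act (g i) (t i)) =
  end_act (end_comp f g) (block_sum t).
Proof.
apply: multilin_eq => v /=; congr (f _); apply: funext => i; congr (g i _).
apply: funext => j; congr v; apply: (@perm_inj _ (block_sum t)).
by rewrite permKV permE block_sum_Rank permKV.
Qed.

Lemma end_comp_actl n (k : 'I_n -> nat) (f : end_space n)
    (g : forall i, end_space (k i)) (s : 'S_n) :
  Tagged end_space (end_comp (end_act f s) (fun i => g (s i))) =
  Tagged end_space (end_act (end_comp f g) (block_perm k s)).
Proof.
apply: (end_Tagged (e := esym (sum_perm k s))) => v /=; congr (f _).
apply: funext => i; have [i' ->] : exists i', i = s i'.
  by exists (s^-1%g i); rewrite permKV.
move: (s^-1%g (s i')) (permK s i') => _ ->.
congr (g (s i') _); apply: funext => j; congr v.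
apply: (@perm_inj _ (block_perm k s)).
by rewrite permKV permE block_perm_Rank.
Qed.

Lemma end_compA n (k : 'I_n -> nat) (l : forall i, 'I_(k i) -> nat)
    (f : end_space n) (g : forall i, end_space (k i))
    (h : forall i (j : 'I_(k i)), end_space (l i j)) :
  Tagged end_space (end_comp f (fun i => end_comp (g i) (h i))) =
  Tagged end_space (end_comp (end_comp f g)
    (fun s => h (sig1 s) (sig2 s))).
Proof.
have e := big_tagnat addn l.
apply: (end_Tagged (e := e)) => v /=; congr (f _); apply: funext => i.
congr (g i _); apply: funext => j.
pose G i j := h i j (fun q => v (cast_ord e (Rank i (Rank j q)))).
rewrite -[LHS]/(G i j).
transitivity (G (sig1 (Rank i j)) (sig2 (Rank i j))).
  by rewrite /sig1 /sig2 /Rank rankK.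
move: (Rank i j) => s; congr (h _ _ _); apply: funext => q; congr v.
by apply: val_inj; rewrite [RHS]Rank_sig.
Qed.

Definition end_operad : sym_operad K :=
  SymOperad end_act_linear end_act1 end_actM end_comp_linearl end_comp_linearr
    end_comp_unitl end_comp_unitr end_compA end_comp_actl end_comp_actr.

End End.

Section OperadAlgebras.
Variables (K : fieldType) (P : sym_operad K).

Structure op_algebra := OpAlgebra {
  oa_space :> lmodType K;
  oa_struct : operad_morphism P (end_operad oa_space)
}.

(* The second equation is f o Phi(x) = Phi(x) o f^{(x) n} on pure tensors.     *)
Structure op_alg_morphism (A B : op_algebra) := OpAlgMorphism {
  oam_fun :> A -> B;
  oam_linear : linear oam_fun;
  oam_struct : forall n (x : P n) (v : 'I_n -> A),
    oam_fun (oa_struct A n x v) = oa_struct B n x (fun i => oam_fun (v i))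
}.

Lemma oam_eq (A B : op_algebra) (f g : op_alg_morphism A B) : f =1 g -> f = g.
Proof.
case: f g => [f fl fs] [g gl gs] /= /funext e; subst g.
by congr OpAlgMorphism; exact: Prop_irrelevance.
Qed.

Definition oam_id (A : op_algebra) : op_alg_morphism A A :=
  @OpAlgMorphism A A id (fun _ _ _ => erefl) (fun _ _ _ => erefl).

Section Composition.
Variables (A B C : op_algebra) (g : op_alg_morphism B C) (f : op_alg_morphism A B).

Let comp_linear : linear (fun x => g (f x)).
Proof. by move=> a x y; rewrite !oam_linear. Qed.

Let comp_struct n (x : P n) (v : 'I_n -> A) :
  g (f (oa_struct A n x v)) = oa_struct C n x (fun i => g (f (v i))).
Proof. by rewrite !oam_struct. Qed.

Definition oam_comp : op_alg_morphism A C := OpAlgMorphism comp_linear comp_struct.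
End Composition.

Lemma oam_comp1 A B (f : op_alg_morphism A B) : oam_comp f (oam_id A) = f.
Proof. exact: oam_eq. Qed.

Lemma oam_1comp A B (f : op_alg_morphism A B) : oam_comp (oam_id B) f = f.
Proof. exact: oam_eq. Qed.

Lemma oam_compA A B C D (h : op_alg_morphism C D) (g : op_alg_morphism B C) (f : op_alg_morphism A B) :
  oam_comp h (oam_comp g f) = oam_comp (oam_comp h g) f.
Proof. exact: oam_eq. Qed.

Definition Alg : category := Category oam_comp1 oam_1comp oam_compA.

End OperadAlgebras.

Section CommAlg.
Variable K : fieldType.

Structure comm_algebra := CommAlgebra {
  ca_space :> lmodType K;
  ca_mul : ca_space -> ca_space -> ca_space;
  ca_mul_linearl : forall y, linear (ca_mul^~ y);
  ca_mul_linearr : forall x, linear (ca_mul x);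
  ca_mulA : associative ca_mul;
  ca_mulC : commutative ca_mul
}.

Structure comm_alg_morphism (A B : comm_algebra) := CommAlgMorphism {
  cam_fun :> A -> B;
  cam_linear : linear cam_fun;
  cam_mul : {morph cam_fun : x y / ca_mul x y}
}.

Lemma cam_eq (A B : comm_algebra) (f g : comm_alg_morphism A B) :
  f =1 g -> f = g.
Proof.
case: f g => [f fl fs] [g gl gs] /= /funext e; subst g.
by congr CommAlgMorphism; exact: Prop_irrelevance.
Qed.

Definition cam_id (A : comm_algebra) : comm_alg_morphism A A :=
  @CommAlgMorphism A A id (fun _ _ _ => erefl) (fun _ _ => erefl).

Section Composition.
Variables (A B C : comm_algebra) (g : comm_alg_morphism B C) (f : comm_alg_morphism A B).

Let comp_linear : linear (fun x => g (f x)).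
Proof. by move=> a x y; rewrite !cam_linear. Qed.

Let comp_mul : {morph (fun x => g (f x)) : x y / ca_mul x y}.
Proof. by move=> x y; rewrite !cam_mul. Qed.

Definition cam_comp : comm_alg_morphism A C := CommAlgMorphism comp_linear comp_mul.
End Composition.

Lemma cam_comp1 A B (f : comm_alg_morphism A B) : cam_comp f (cam_id A) = f.
Proof. exact: cam_eq. Qed.

Lemma cam_1comp A B (f : comm_alg_morphism A B) : cam_comp (cam_id B) f = f.
Proof. exact: cam_eq. Qed.

Lemma cam_compA A B C D (h : comm_alg_morphism C D) (g : comm_alg_morphism B C) (f : comm_alg_morphism A B) :
  cam_comp h (cam_comp g f) = cam_comp (cam_comp h g) f.
Proof. exact: cam_eq. Qed.

Definition CommAlg : category := Category cam_comp1 cam_1comp cam_compA.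

End CommAlg.

(* Main.v *)
(* A Com-algebra structure on V is determined by the binary product            *)
(* Phi_2 (mu_2): the relation mu_2 o (mu_m, mu_n) = mu_(m + n) gives           *)
(* associativity (splitting mu_3 in two ways) and, by induction, the value of  *)
(* every Phi_n (mu_n) as an iterated product, while invariance of mu_2 under   *)
(* the transposition gives commutativity. Conversely the n-fold products of a  *)
(* commutative algebra, indexed by finite sets, are compatible with            *)
(* permutations and block decompositions by reindexing. Both constructions     *)
(* leave the underlying spaces and maps unchanged, so they are strictly        *)
(* inverse functors.                                                           *)
From mathcomp Require Import all_boot all_order all_algebra all_fingroup.
From mathcomp Require Import boolp functions.
Require Import Defs.

Set Implicit Arguments.
Unset Strict Implicit.
Unset Printing Implicit Defensive.

Import GRing.Theory.
Local Open Scope ring_scope.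

(** Since Com(n) is spanned by mu_n, a Com-algebra amounts to the operations Phi_n(mu_n). [mu_evalD]
    turns mu_2 o (mu_m, mu_n) = mu_(m+n) into a product formula; it yields [oa_mulA] and, in
    [mu_eval_ca_prod], forces Phi_n(mu_n) to be the n-fold product for n > 0. Conversely, regrouping
    into blocks ([ca_prod_block]) and reordering ([ca_prod_perm]) make the n-fold products an operad
    morphism. A linear map preserving binary products preserves all n-fold ones ([cam_ca_prod]), so
    both categories have the same morphisms. The round trips on objects are [comm_of_oaK] and
    [oa_of_commK]; [functor_ext] lifts them to equalities of functors. *)

Lemma functor_ext (C D : category) (F G : functor C D) :
    (forall x, F x = G x) ->
    (forall x y (f : hom x y),
      existT (fun p => hom p.1 p.2) (F x, F y) (fhom F f) =
      existT (fun p => hom p.1 p.2) (G x, G y) (fhom G f)) ->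
  F = G.
Proof.
case: F G => [F Fh F1 FM] [G Gh G1 GM] /= /funext FG; subst G => FGh.
have {}FGh : Fh = Gh.
  apply: functional_extensionality_dep => x.
  apply: functional_extensionality_dep => y; apply: funext => f.
  (* Both arrows now have the same endpoints, so by proof irrelevance the transport is along
     [erefl]. *)
  have := projT2_eq (FGh x y f).
  by rewrite (Prop_irrelevance (projT1_eq (FGh x y f)) erefl).
by subst Gh; congr Functor; exact: Prop_irrelevance.
Qed.

Section LinearPredicate.
Variables (K : fieldType) (U V : lmodType K) (f : U -> V).
Hypothesis f_lin : linear f.

Lemma linear_map0 : f 0 = 0.
Proof. by have := f_lin (-1) 0 0; rewrite !scaleN1r !addNr. Qed.

Lemma linear_mapZ a x : f (a *: x) = a *: f x.
Proof. by have := f_lin a x 0; rewrite !addr0 linear_map0 addr0. Qed.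

End LinearPredicate.

Definition vec2 (T : Type) (a b : T) (i : 'I_2) : T := if i == 0 then a else b.

Lemma vec2_dfwithl (T : Type) (a b x : T) :
  fwith (vec2 a b) 0 x = vec2 x b.
Proof.
apply: funext => i; case: (eqVneq 0 i) => [<-|i0]; first by rewrite dfwith_in.
by rewrite dfwith_out // /vec2 eq_sym (negPf i0).
Qed.

Lemma vec2_dfwithr (T : Type) (a b x : T) :
  fwith (vec2 a b) 1 x = vec2 a x.
Proof.
apply: funext => i; case: (eqVneq 1 i) => [<-|i1]; first by rewrite dfwith_in.
by rewrite dfwith_out // /vec2; case: i i1 => [[|[|]]].
Qed.

Lemma com_comp_mu (K : fieldType) n (k : 'I_n -> nat) :
    (0 < n)%N -> (forall i, 0 < k i)%N ->
  com_comp (mu K n) (fun i => mu K (k i)) = mu K (\sum_(i < n) k i).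
Proof.
move=> n0 k0; have c m : (0 < m)%N -> com_coef (mu K m) = 1 by case: m.
rewrite /com_comp c // mul1r [X in X *: _]big1 ?scale1r // => i _.
by rewrite c.
Qed.

(** * The binary product of a Com-algebra *)

Section FromOperadAlgebra.
Variables (K : fieldType) (A : op_algebra (Com K)).

(** Inputs come from a sequence on [nat], so equations between arities can be rewritten without
    casting ordinals. *)
Definition mu_eval n (w : nat -> A) : A :=
  oa_struct A n (mu K n) (fun i : 'I_n => w i).

Definition oa_mul (a b : A) : A := oa_struct A 2 (mu K 2) (vec2 a b).

Lemma mu_eval1 w : mu_eval 1 w = w 0.
Proof. by rewrite /mu_eval (om_unit (oa_struct A)). Qed.

(** This is mu_2 o (mu_m, mu_n) = mu_(m+n); positivity is essential because [mu K 0] is zero. *)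
Lemma mu_evalD m n w : (0 < m)%N -> (0 < n)%N ->
  mu_eval (m + n) w = oa_mul (mu_eval m w) (mu_eval n (fun j => w (m + j)%N)).
Proof.
move=> m0 n0; pose k : 'I_2 -> nat := vec2 m n.
have kE : (\sum_(i < 2) k i = m + n)%N by rewrite big_ord_recl big_ord1.
have k0 i : (0 < k i)%N by rewrite /k /vec2; case: ifP.
rewrite -{1}kE /mu_eval -com_comp_mu //.
have /= -> := om_comp (oa_struct A) (mu K 2) (fun i => mu K (k i)).
rewrite /oa_mul /=; congr (oa_struct A 2 _ _); apply: funext => i.
have RE (j : 'I_(k i)) :
    nat_of_ord (tagnat.Rank i j) = ((if i == 0%R then 0 else m) + j)%N.
  rewrite [LHS]tagnat.RankEsum; congr addn.
  rewrite big_mkcond !big_ord_recl big_ord0.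
  by case: i {j} => [[|[|i]] lti] //=; rewrite !addn0.
transitivity (oa_struct A (k i) (mu K (k i))
    (fun j => w ((if i == 0%R then 0 else m) + j)%N)).
  by congr (oa_struct A _ _ _); apply: funext => j; rewrite -RE.
by rewrite /k /vec2; case: ifP.
Qed.

Lemma mu_eval2 w : mu_eval 2 w = oa_mul (w 0) (w 1).
Proof. by rewrite (@mu_evalD 1 1) // !mu_eval1. Qed.

Lemma oa_mul_linearl y : linear (oa_mul^~ y).
Proof.
move=> a x x'; rewrite /oa_mul.
by have := multilinP (oa_struct A 2 (mu K 2)) (vec2 0 y) 0 a x x';
  rewrite !vec2_dfwithl.
Qed.

Lemma oa_mul_linearr x : linear (oa_mul x).
Proof.
move=> a y y'; rewrite /oa_mul.
by have := multilinP (oa_struct A 2 (mu K 2)) (vec2 x 0) 1 a y y';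
  rewrite !vec2_dfwithr.
Qed.

Lemma oa_mulA : associative oa_mul.
Proof.
move=> x y z; pose w := nth 0 [:: x; y; z].
have := @mu_evalD 2 1 w isT isT.
(* [2 + 1] and [1 + 2] are convertible, so the same value of mu_3 is also split the other way. *)
by rewrite (@mu_evalD 1 2) // !mu_eval2 !mu_eval1.
Qed.

Lemma oa_mulC : commutative oa_mul.
Proof.
move=> x y; rewrite /oa_mul.
have /= := om_act (oa_struct A) (mu K 2) (tperm 0 1).
move/(congr1 (fun f : multilin A 2 => f (vec2 x y))); rewrite /com_act /= => ->.
congr (oa_struct A 2 _ _); apply: funext => i; rewrite tpermV /vec2.
by case: tpermP => [->|->|/eqP + /eqP] //; case: i => [[|[|]]].
Qed.

Definition comm_of_oa : comm_algebra K :=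
  CommAlgebra oa_mul_linearl oa_mul_linearr oa_mulA oa_mulC.

End FromOperadAlgebra.

(** * The n-fold products of a commutative algebra as a Com-structure *)

Section FromCommAlgebra.
Variables (K : fieldType) (A : comm_algebra K).

(* The product of a finite family, None standing for the missing unit.         *)
Notation omul := (oAC (@ca_mulA K A) (@ca_mulC K A)).

Definition oprod n (v : 'I_n -> A) : option A :=
  \big[omul/None]_(i < n) Some (v i).

(* For n = 0 the product is 0; it is irrelevant since Com(0) = 0.              *)
Definition ca_prod n (v : 'I_n -> A) : A := odflt 0 (oprod v).

Lemma Some_ca_prod n (v : 'I_n -> A) : (0 < n)%N -> Some (ca_prod v) = oprod v.
Proof.
case: n v => // n v _; rewrite /ca_prod /oprod big_ord_recl.
by case: (\big[_/_]_(i < n) _).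
Qed.

Lemma ca_prod1 (v : 'I_1 -> A) : ca_prod v = v 0.
Proof. by rewrite /ca_prod /oprod big_ord1. Qed.

Lemma ca_prodSr n (v : 'I_n.+2 -> A) :
  ca_prod v = ca_mul (ca_prod (fun i => v (widen_ord (leqnSn _) i))) (v ord_max).
Proof.
apply: Some_inj; rewrite Some_ca_prod // /oprod big_ord_recr /=.
by rewrite -/(oprod _) -Some_ca_prod.
Qed.

Lemma ca_prod2 (v : 'I_2 -> A) : ca_prod v = ca_mul (v 0) (v 1).
Proof.
rewrite ca_prodSr ca_prod1.
by congr ca_mul; congr v; apply: val_inj.
Qed.

Lemma ca_prod_perm n (v : 'I_n -> A) (s : 'S_n) :
  ca_prod (fun i => v (s i)) = ca_prod v.
Proof.
by rewrite /ca_prod /oprod [in RHS](reindex_inj (@perm_inj _ s)).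
Qed.

Lemma ca_prod_multilinear n : multilinear (@ca_prod n).
Proof.
(* [r] is the product of the other factors, and is [None] exactly when there are none. *)
move=> v i; pose r := \big[omul/None]_(j < n | j != i) Some (v j).
have prodE x : ca_prod (fwith v i x) = if r is Some y then ca_mul x y else x.
  rewrite /ca_prod /oprod (bigD1 i) //= dfwith_in.
  rewrite (eq_bigr (fun j => Some (v j))) -/r; first by case: r.
  by move=> j ji; rewrite dfwith_out // eq_sym.
move=> a x y; rewrite !prodE; case: (r) => // z.
exact: (ca_mul_linearl z).
Qed.

(** Generalized associativity. Blocks must be nonempty: an empty one would contribute the factor 0
    instead of being skipped. *)
Lemma ca_prod_block n (k : 'I_n -> nat) (v : 'I_(\sum_(i < n) k i) -> A) :
    (forall i, 0 < k i)%N ->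
  ca_prod (fun i => ca_prod (fun j => v (tagnat.Rank i j))) = ca_prod v.
Proof.
move=> k0; rewrite /ca_prod; congr odflt.
transitivity (\big[omul/None]_(i < n) oprod (fun j => v (tagnat.Rank i j))).
  by apply: eq_bigr => i _; rewrite Some_ca_prod.
rewrite /oprod (big_tagnat omul (fun i j => Some (v (tagnat.Rank i j)))).
by apply: eq_bigr => s _; rewrite tagnat.sig2K.
Qed.

Lemma com_struct_subproof n (x : Com K n) :
  multilinear (fun v : 'I_n -> A => com_coef x *: ca_prod v).
Proof.
move=> v i a y z; rewrite ca_prod_multilinear scalerDr !scalerA.
by rewrite [_ * a]mulrC.
Qed.

Definition com_struct n (x : Com K n) : end_operad A n :=
  mk_multilin (@com_struct_subproof n x).

Lemma com_struct_linear n : linear (@com_struct n).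
Proof.
move=> a x y; apply: multilin_eq => v.
by rewrite multilinDE /= com_coef_linear scalerDl scalerA.
Qed.

Lemma com_struct_comp n (k : 'I_n -> nat) (x : Com K n)
    (y : forall i, Com K (k i)) :
  com_struct (op_comp x y) = op_comp (com_struct x) (fun i => com_struct (y i)).
Proof.
apply: multilin_eq => v /=; rewrite com_coef_comp.
have scale_prod m (c : 'I_m -> K) (u : 'I_m -> A) : (0 < m)%N ->
    ca_prod (fun i => c i *: u i) = (\prod_(i < m) c i) *: ca_prod u.
  case: m c u => // m c u _; elim: m => [|m IH] in c u *.
    by rewrite !ca_prod1 big_ord1.
  rewrite !ca_prodSr big_ord_recr /= IH (linear_mapZ (ca_mul_linearr _)).
  by rewrite (linear_mapZ (ca_mul_linearl _)) scalerA [_ * c _]mulrC.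
(* If [x], or below some [y i], has arity 0, its coefficient vanishes and both sides are 0;
   otherwise [ca_prod_block] applies. *)
case: (posnP n) => [n0|n0]; first by rewrite !com_coef0 // !mul0r !scale0r.
rewrite scale_prod // -scalerA; congr (_ *: _).
case: (pselect (forall i, 0 < k i)%N) => [k0|/existsNP[i /negP]].
  by rewrite ca_prod_block.
rewrite -eqn0Ngt => /eqP k0.
by rewrite (bigD1 i) //= com_coef0 // mul0r !scale0r.
Qed.

Lemma com_struct_unit : com_struct (op_unit (P := Com K)) = op_unit.
Proof.
by apply: multilin_eq => v /=; rewrite ca_prod1 scale1r.
Qed.

Lemma com_struct_act n (x : Com K n) (s : 'S_n) :
  com_struct (op_act x s) = op_act (com_struct x) s.
Proof. by apply: multilin_eq => v /=; rewrite ca_prod_perm. Qed.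

Definition oa_of_comm : op_algebra (Com K) :=
  OpAlgebra (OperadMorphism com_struct_linear com_struct_comp com_struct_unit
    com_struct_act).

End FromCommAlgebra.

Lemma cam_ca_prod (K : fieldType) (A B : comm_algebra K)
    (f : comm_alg_morphism A B) n (v : 'I_n -> A) :
  f (ca_prod v) = ca_prod (fun i => f (v i)).
Proof.
case: n v => [|n] v.
  by rewrite /ca_prod /oprod !big_ord0 (linear_map0 (cam_linear f)).
elim: n => [|n IH] in v *; first by rewrite !ca_prod1.
by rewrite !ca_prodSr cam_mul IH.
Qed.

(** * The two functors, and why they are mutually inverse *)

Section OnMorphisms.
Variable K : fieldType.

Lemma oam_mul (A B : op_algebra (Com K)) (f : op_alg_morphism A B) :
  {morph f : x y / oa_mul x y}.
Proof.
move=> x y; rewrite /oa_mul oam_struct; congr (oa_struct B 2 _ _).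
by apply: funext => i; rewrite /vec2; case: ifP.
Qed.

Definition cam_of_oam (A B : op_algebra (Com K)) (f : op_alg_morphism A B) :
    comm_alg_morphism (comm_of_oa A) (comm_of_oa B) :=
  @CommAlgMorphism K (comm_of_oa A) (comm_of_oa B) f (oam_linear f) (oam_mul f).

Lemma cam_com_struct (A B : comm_algebra K) (f : comm_alg_morphism A B)
    n (x : Com K n) (v : 'I_n -> A) :
  f (com_struct A x v) = com_struct B x (fun i => f (v i)).
Proof. by rewrite /= (linear_mapZ (cam_linear f)) cam_ca_prod. Qed.

Definition oam_of_cam (A B : comm_algebra K) (f : comm_alg_morphism A B) :
    op_alg_morphism (oa_of_comm A) (oa_of_comm B) :=
  @OpAlgMorphism K (Com K) (oa_of_comm A) (oa_of_comm B) f (cam_linear f)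
    (cam_com_struct f).

Lemma cam_of_oam1 (A : ob (Alg (Com K))) :
  cam_of_oam (idm A) = idm (comm_of_oa A : ob (CommAlg K)).
Proof. exact: cam_eq. Qed.

Lemma cam_of_oamM (A B C : ob (Alg (Com K))) (g : hom B C) (f : hom A B) :
  cam_of_oam (compm g f) =
  compm (c := CommAlg K) (cam_of_oam g) (cam_of_oam f).
Proof. exact: cam_eq. Qed.

Definition AlgCom_to_CommAlg : functor (Alg (Com K)) (CommAlg K) :=
  @Functor (Alg (Com K)) (CommAlg K) (@comm_of_oa K) cam_of_oam
    cam_of_oam1 cam_of_oamM.

Lemma oam_of_cam1 (A : ob (CommAlg K)) :
  oam_of_cam (idm A) = idm (oa_of_comm A : ob (Alg (Com K))).
Proof. exact: oam_eq. Qed.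

Lemma oam_of_camM (A B C : ob (CommAlg K)) (g : hom B C) (f : hom A B) :
  oam_of_cam (compm g f) =
  compm (c := Alg (Com K)) (oam_of_cam g) (oam_of_cam f).
Proof. exact: oam_eq. Qed.

Definition CommAlg_to_AlgCom : functor (CommAlg K) (Alg (Com K)) :=
  @Functor (CommAlg K) (Alg (Com K)) (@oa_of_comm K) oam_of_cam
    oam_of_cam1 oam_of_camM.

(* The objects below have the same carrier by conversion, which is what makes  *)
(* it possible to compare morphisms as functions.                              *)
Lemma oa_of_commK (A : comm_algebra K) :
  @ca_mul K (comm_of_oa (oa_of_comm A)) = @ca_mul K A.
Proof.
apply: funext => x; apply: funext => y /=.
by rewrite /oa_mul /= scale1r ca_prod2.
Qed.

(** Uniqueness of the Com-structure: splitting off the last input by mu_(n+2) = mu_2 o (mu_(n+1),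
    mu_1) gives the same recursion as [ca_prodSr]. *)
Lemma mu_eval_ca_prod (A : op_algebra (Com K)) n (w : nat -> A) :
  mu_eval n.+1 w = ca_prod (A := comm_of_oa A) (fun i : 'I_n.+1 => w i).
Proof.
elim: n => [|n IH]; first by rewrite mu_eval1 ca_prod1.
by rewrite ca_prodSr -[in LHS]addn1 mu_evalD // mu_eval1 addn0 IH.
Qed.

Lemma comm_of_oaK (A : op_algebra (Com K)) :
  oa_struct (oa_of_comm (comm_of_oa A)) = oa_struct A.
Proof.
have : om_fun (oa_struct (oa_of_comm (comm_of_oa A))) = om_fun (oa_struct A).
  apply: functional_extensionality_dep => n; apply: funext => x.
  (* Linearity reduces the claim to [mu K n]. *)
  apply: multilin_eq => v /=; rewrite -[in RHS](com_coefK x).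
  rewrite (linear_mapZ (om_linear (oa_struct A) (n := n))).
  case: n x v => [|n] x v; first by rewrite (com_coef0 x) // !scale0r.
  (* [inord] extends the finite family [v] to a sequence on [nat], as [mu_eval] requires. *)
  congr (_ *: _); have := @mu_eval_ca_prod A n (fun i => v (inord i)).
  have -> : (fun i : 'I_n.+1 => v (inord i) : A) = v.
    by apply: funext => i; rewrite inord_val.
  move=> <-; rewrite /mu_eval; congr (oa_struct A _ _ _).
  by apply: funext => i; rewrite inord_val.
case: (oa_struct _) (oa_struct A) => [F F1 F2 F3 F4] [G G1 G2 G3 G4] /= e.
by subst G; congr OperadMorphism; exact: Prop_irrelevance.
Qed.

Lemma comm_algebra_eq (V : lmodType K) m l r a c m' l' r' a' c' :
  m = m' ->
  @CommAlgebra K V m l r a c = @CommAlgebra K V m' l' r' a' c'.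
Proof. by move=> e; subst m'; congr CommAlgebra; exact: Prop_irrelevance. Qed.

(** The carriers are shared, so the underlying functions can be compared without transport; once the
    products agree, so do the proofs of the laws, by irrelevance. *)
Lemma comm_alg_hom_eq (U V : lmodType K) m l r a c m' l' r' a' c'
    n p q s t n' p' q' s' t' (A := @CommAlgebra K U m l r a c)
    (A' := @CommAlgebra K U m' l' r' a' c')
    (B := @CommAlgebra K V n p q s t) (B' := @CommAlgebra K V n' p' q' s' t')
    (f : comm_alg_morphism A B) (f' : comm_alg_morphism A' B') :
    m = m' -> n = n' -> cam_fun f = cam_fun f' ->
  existT (fun p : ob (CommAlg K) * ob (CommAlg K) => hom p.1 p.2) (A, B) f =
  existT (fun p : ob (CommAlg K) * ob (CommAlg K) => hom p.1 p.2) (A', B') f'.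
Proof.
move=> em en; subst m' n'.
rewrite {}/A {}/A' {}/B {}/B' in f f' *.
have ? := Prop_irrelevance l l'; have ? := Prop_irrelevance r r'.
have ? := Prop_irrelevance a a'; have ? := Prop_irrelevance c c'.
have ? := Prop_irrelevance p p'; have ? := Prop_irrelevance q q'.
have ? := Prop_irrelevance s s'; have ? := Prop_irrelevance t t'.
subst l' r' a' c' p' q' s' t' => e.
by congr existT; apply: cam_eq => x; rewrite e.
Qed.

Lemma op_alg_hom_eq (P : sym_operad K) (U V : lmodType K)
    (u u' : operad_morphism P (end_operad U))
    (v v' : operad_morphism P (end_operad V))
    (f : op_alg_morphism (OpAlgebra u) (OpAlgebra v))
    (f' : op_alg_morphism (OpAlgebra u') (OpAlgebra v')) :
    u = u' -> v = v' -> oam_fun f = oam_fun f' ->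
  existT (fun p : ob (Alg P) * ob (Alg P) => hom p.1 p.2)
    (OpAlgebra u, OpAlgebra v) f =
  existT (fun p : ob (Alg P) * ob (Alg P) => hom p.1 p.2)
    (OpAlgebra u', OpAlgebra v') f'.
Proof.
move=> eu ev; subst u' v' => e.
by congr existT; apply: oam_eq => x; rewrite e.
Qed.

Lemma AlgCom_to_CommAlgK :
  compF CommAlg_to_AlgCom AlgCom_to_CommAlg = idF (Alg (Com K)).
Proof.
apply: functor_ext => [[V u]|[V u] [W v] f].
  by congr OpAlgebra; exact: (comm_of_oaK (OpAlgebra u)).
apply: op_alg_hom_eq => //; first exact: (comm_of_oaK (OpAlgebra u)).
exact: (comm_of_oaK (OpAlgebra v)).
Qed.

Lemma CommAlg_to_AlgComK :
  compF AlgCom_to_CommAlg CommAlg_to_AlgCom = idF (CommAlg K).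
Proof.
apply: functor_ext => [[V m l r a c]|[V m l r a c] [W n p q s t] f].
  by apply: comm_algebra_eq; exact: (oa_of_commK (CommAlgebra l r a c)).
apply: comm_alg_hom_eq => //; first exact: (oa_of_commK (CommAlgebra l r a c)).
exact: (oa_of_commK (CommAlgebra p q s t)).
Qed.

End OnMorphisms.

Theorem theorem3p75 (K : fieldType) (charK : [pchar K] =i pred0) :
  isomorphic_cat (Alg (Com K)) (CommAlg K).
Proof.
exists (AlgCom_to_CommAlg K), (CommAlg_to_AlgCom K); split.
  exact: AlgCom_to_CommAlgK.
exact: CommAlg_to_AlgComK.
Qed.
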